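(* Let $R$ be a ring and let $\mathcal{I}$ be an ideal of $\operatorname{Hom}_R$ (in the category of left $R$-modules) that is generated by a set of homomorphisms in the extended sense. Then $\mathcal{I}^{\perp}$ is a preenveloping ideal, i.e. every left $R$-module has an $\mathcal{I}^{\perp}$-preenvelope.
   Context: $R$ is an arbitrary ring; modules are left $R$-modules. An ideal is an additive subfunctor of $\operatorname{Hom}_R$, i.e. a class $\mathcal{I}$ of $R$-homomorphisms such that for all modules $M,N$ the members of $\mathcal I$ from $M$ to $N$ form a subgroup of $\operatorname{Hom}_R(M,N)$, and $f\circ g\circ h\in\mathcal{I}$ whenever $g\in\mathcal{I}$ and $f,h$ are composable homomorphisms. Let $(f_s:M_s\to N_s)_{s\in S}$ be a set of homomorphisms. The ideal $\mathcal{I}$ is generated by $(f_s)_{s\in S}$ in the extended sense if $\mathcal{I}$ consists exactly of the homomorphisms $U\to V$ that have a factorization $$U\longrightarrow \bigoplus_{s\in S}M_s^{(\kappa_s)}\xrightarrow{\ \bigoplus f_s\ }\bigoplus_{s\in S}N_s^{(\kappa_s)}\longrightarrow V$$ for some cardinal numbers $\kappa_s$ ($s\in S$), where $M^{(\kappa)}$ denotes the direct sum of $\kappa$ copies of $M$ and $\bigoplus f_s$ is the direct sum of $\kappa_s$ copies of $f_s$, over all $s\in S$. For homomorphisms $i: Z\to Y$ and $j:U\to V$, $\operatorname{Ext}^1(i,j):\operatorname{Ext}^1_R(Y,U)\to\operatorname{Ext}^1_R(Z,V)$ is the map sending (the class of) a short exact sequence $0\to U\to X\to Y\to 0$ to the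 one obtained by pushout along $j$ followed by pullback along $i$. For an ideal $\mathcal{I}$, $\mathcal{I}^{\perp}=\{j \mid \operatorname{Ext}^1(i,j)=0 \text{ for all } i\in\mathcal{I}\}$. For an ideal $\mathcal{J}$, a $\mathcal{J}$-preenvelope of a module $U$ is a homomorphism $j:U\to J$ in $\mathcal{J}$ such that every homomorphism $j':U\to J'$ in $\mathcal{J}$ factors as $j'=h\circ j$ for some homomorphism $h:J\to J'$. *)

(* Defs.v *)
From HB Require Import structures.
From mathcomp Require Import all_boot all_algebra generic_quotient.
From mathcomp Require Import boolp classical_sets cardinality.

Set Implicit Arguments.
Unset Strict Implicit.
Unset Printing Implicit Defensive.

Import GRing.Theory.
Local Open Scope ring_scope.
Local Open Scope quotient_scope.

Section DirectSum.
Variables (R : pzRingType) (I : Type).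

Definition fin_supp (M : I -> lmodType R) (x : forall i, M i) : Prop :=
  finite_set [set i | x i <> 0].

(* The index type is bounded by the universe of the carriers of the modules,
   so it plays the role of a set (as opposed to a proper class). *)
Record dsum (M : I -> lmodType R) := Dsum {
  dsum_val :> forall i, M i;
  dsum_fin : fin_supp dsum_val
}.

Section Structure.
Variable M : I -> lmodType R.
Implicit Types x y z : dsum M.

Lemma dsum_ext x y : (forall i, x i = y i) -> x = y.
Proof.
case: x y => [x xfin] [y yfin] /= xy.
have {}xy : x = y by apply: functional_extensionality_dep.
by subst y; congr Dsum; apply: Prop_irrelevance.
Qed.

HB.instance Definition _ := gen_eqMixin (dsum M).
HB.instance Definition _ := gen_choiceMixin (dsum M).

Lemma fin_supp0 : @fin_supp M (fun=> 0).
Proof. by apply: sub_finite_set (finite_set0 I) => i /=. Qed.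

Lemma fin_suppD x y : @fin_supp M (fun i => x i + y i).
Proof.
apply: (@sub_finite_set _ _ ([set i | x i <> 0] `|` [set i | y i <> 0])).
  move=> i /= xy; have [x0|x0] := pselect (x i = 0); last by left.
  by right=> y0; apply: xy; rewrite x0 y0 addr0.
by rewrite finite_setU; split; apply: dsum_fin.
Qed.

Lemma fin_suppN x : @fin_supp M (fun i => - x i).
Proof.
by apply: sub_finite_set (dsum_fin x) => i /= x0 xi; apply: x0; rewrite xi oppr0.
Qed.

Lemma fin_suppZ (a : R) x : @fin_supp M (fun i => a *: x i).
Proof.
by apply: sub_finite_set (dsum_fin x) => i /= x0 xi; apply: x0; rewrite xi scaler0.
Qed.

Definition dsum_zero : dsum M := Dsum fin_supp0.
Definition dsum_add x y : dsum M := Dsum (fin_suppD x y).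
Definition dsum_opp x : dsum M := Dsum (fin_suppN x).
Definition dsum_scale (a : R) x : dsum M := Dsum (fin_suppZ a x).

Lemma dsum_addA : associative dsum_add.
Proof. by move=> x y z; apply: dsum_ext => i /=; rewrite addrA. Qed.
Lemma dsum_addC : commutative dsum_add.
Proof. by move=> x y; apply: dsum_ext => i /=; rewrite addrC. Qed.
Lemma dsum_add0 : left_id dsum_zero dsum_add.
Proof. by move=> x; apply: dsum_ext => i /=; rewrite add0r. Qed.
Lemma dsum_addN : left_inverse dsum_zero dsum_opp dsum_add.
Proof. by move=> x; apply: dsum_ext => i /=; rewrite addNr. Qed.

HB.instance Definition _ := GRing.isZmodule.Build (dsum M)
  dsum_addA dsum_addC dsum_add0 dsum_addN.

Lemma dsum_scaleA a b x : dsum_scale a (dsum_scale b x) = dsum_scale (a * b) x.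
Proof. by apply: dsum_ext => i /=; rewrite scalerA. Qed.
Lemma dsum_scale1 : left_id 1 dsum_scale.
Proof. by move=> x; apply: dsum_ext => i /=; rewrite scale1r. Qed.
Lemma dsum_scaleDr : right_distributive dsum_scale +%R.
Proof. by move=> a x y; apply: dsum_ext => i /=; rewrite scalerDr. Qed.
Lemma dsum_scaleDl x : {morph dsum_scale^~ x : a b / a + b}.
Proof. by move=> a b; apply: dsum_ext => i /=; rewrite scalerDl. Qed.

HB.instance Definition _ := GRing.Zmodule_isLmodule.Build R (dsum M)
  dsum_scaleA dsum_scale1 dsum_scaleDr dsum_scaleDl.
End Structure.

Section Map.
Variables (M N : I -> lmodType R) (f : forall i, {linear M i -> N i}).

Lemma fin_supp_map (x : dsum M) : @fin_supp N (fun i => f i (x i)).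
Proof.
by apply: sub_finite_set (dsum_fin x) => i /= f0 xi; apply: f0; rewrite xi linear0.
Qed.

Definition dsum_map (x : dsum M) : dsum N := Dsum (fin_supp_map x).

Lemma dsum_map_is_linear : linear dsum_map.
Proof. by move=> a x y; apply: dsum_ext => i /=; rewrite linearP. Qed.

HB.instance Definition _ :=
  GRing.isLinear.Build R (dsum M) (dsum N) *:%R dsum_map dsum_map_is_linear.
End Map.

End DirectSum.

Section Cokernel.
Variables (R : pzRingType) (U V : lmodType R) (f : {linear U -> V}).

Definition image_pred : {pred V} := fun v => `[< exists u, f u = v >].

Lemma image_pred_closed : submod_closed image_pred.
Proof.
split=> [|a _ _ /asboolP[u <-] /asboolP[v <-]]; apply/asboolP.
  by exists 0; rewrite linear0.
by exists (a *: u + v); rewrite linearP.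
Qed.

HB.instance Definition _ :=
  GRing.isSubmodClosed.Build R V image_pred image_pred_closed.

Definition coker := Quotient.quot image_pred.

HB.instance Definition _ := GRing.Zmodule.on coker.

Definition coker_pi (v : V) : coker := \pi_coker v.

Lemma coker_pi_surj (q : coker) : exists v, coker_pi v = q.
Proof. by exists (repr q); rewrite /coker_pi reprK. Qed.

Lemma coker_pi_eq v w : coker_pi v = coker_pi w <-> exists u, f u = v - w.
Proof.
rewrite /coker_pi; split=> [/eqP|E].
  by rewrite -Quotient.idealrBE => /asboolP.
by apply/eqP; rewrite -Quotient.idealrBE; apply/asboolP.
Qed.

Lemma coker_piD : {morph coker_pi : v w / v + w}.
Proof. by move=> v w; rewrite /coker_pi !piE. Qed.

Definition coker_scale (a : R) (q : coker) : coker := coker_pi (a *: repr q).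

Lemma coker_scaleE a v : coker_scale a (coker_pi v) = coker_pi (a *: v).
Proof.
have /coker_pi_eq[u Eu] : coker_pi (repr (coker_pi v)) = coker_pi v.
  by rewrite /coker_pi reprK.
by apply/coker_pi_eq; exists (a *: u); rewrite linearZ_LR Eu scalerBr.
Qed.

Lemma coker_scaleA a b q : coker_scale a (coker_scale b q) = coker_scale (a * b) q.
Proof. by have [v <-] := coker_pi_surj q; rewrite !coker_scaleE scalerA. Qed.
Lemma coker_scale1 : left_id 1 coker_scale.
Proof. by move=> q; have [v <-] := coker_pi_surj q; rewrite coker_scaleE scale1r. Qed.
Lemma coker_scaleDr : right_distributive coker_scale +%R.
Proof.
move=> a p q; have [v <-] := coker_pi_surj p; have [w <-] := coker_pi_surj q.
by rewrite -coker_piD !coker_scaleE -coker_piD scalerDr.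
Qed.
Lemma coker_scaleDl q : {morph coker_scale^~ q : a b / a + b}.
Proof.
move=> a b; have [v <-] := coker_pi_surj q.
by rewrite !coker_scaleE -coker_piD scalerDl.
Qed.

HB.instance Definition _ := GRing.Zmodule_isLmodule.Build R coker
  coker_scaleA coker_scale1 coker_scaleDr coker_scaleDl.

Lemma coker_pi_is_linear : linear coker_pi.
Proof. by move=> a v w; rewrite coker_piD -coker_scaleE. Qed.

HB.instance Definition _ :=
  GRing.isLinear.Build R V coker *:%R coker_pi coker_pi_is_linear.

Lemma coker_pi_eq0 v : coker_pi v = 0 <-> exists u, f u = v.
Proof.
by rewrite -[0 in X in X <-> _](linear0 coker_pi) coker_pi_eq subr0.
Qed.

Section Lift.
Variables (W : lmodType R) (g : {linear V -> W}) (gf0 : forall u, g (f u) = 0).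

Definition coker_lift of (forall u, g (f u) = 0) :=
  fun q : coker => g (repr q).

Lemma coker_liftE v : coker_lift gf0 (coker_pi v) = g v.
Proof.
have /coker_pi_eq[u Eu] : coker_pi (repr (coker_pi v)) = coker_pi v.
  by rewrite /coker_pi reprK.
by apply/eqP; rewrite /coker_lift -subr_eq0 -linearB -Eu gf0.
Qed.

Lemma coker_lift_is_linear : linear (coker_lift gf0).
Proof.
move=> a p q; have [v <-] := coker_pi_surj p; have [w <-] := coker_pi_surj q.
by rewrite -linearP !coker_liftE linearP.
Qed.

HB.instance Definition _ :=
  GRing.isLinear.Build R coker W *:%R (coker_lift gf0) coker_lift_is_linear.
End Lift.

End Cokernel.

Section Pullback.
Variables (R : pzRingType) (X Z Y : lmodType R).
Variables (p : {linear X -> Y}) (i : {linear Z -> Y}).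

Definition pullback_pred : {pred X * Z} := fun t => p t.1 == i t.2.

Lemma pullback_pred_closed : submod_closed pullback_pred.
Proof.
split=> [|a s t /eqP Es /eqP Et]; apply/eqP; first by rewrite !linear0.
by rewrite !linearP Es Et.
Qed.

HB.instance Definition _ :=
  GRing.isSubmodClosed.Build R (X * Z)%type pullback_pred pullback_pred_closed.

Record pullback := Pullback {
  pullback_val :> X * Z;
  pullback_valP : pullback_val \in pullback_pred
}.

HB.instance Definition _ := [isSub for pullback_val].
HB.instance Definition _ := [Choice of pullback by <:].
HB.instance Definition _ := [SubChoice_isSubLmodule of pullback by <:].

Definition pullback_fst (t : pullback) : X := (pullback_val t).1.
Definition pullback_snd (t : pullback) : Z := (pullback_val t).2.

Lemma pullback_fst_is_linear : linear pullback_fst. Proof. by []. Qed.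
Lemma pullback_snd_is_linear : linear pullback_snd. Proof. by []. Qed.
HB.instance Definition _ :=
  GRing.isLinear.Build R pullback X *:%R pullback_fst pullback_fst_is_linear.
HB.instance Definition _ :=
  GRing.isLinear.Build R pullback Z *:%R pullback_snd pullback_snd_is_linear.

Lemma pullback_comm t : p (pullback_fst t) = i (pullback_snd t).
Proof. by apply/eqP; apply: (pullback_valP t). Qed.

Lemma pullback_ext s t : pullback_fst s = pullback_fst t ->
  pullback_snd s = pullback_snd t -> s = t.
Proof.
by move=> E1 E2; apply: val_inj; apply: injective_projections.
Qed.

Section Lift.
Variables (W : lmodType R) (g : {linear W -> X}) (h : {linear W -> Z}).
Variable gh : forall w, p (g w) = i (h w).

Definition pullback_lift (w : W) : pullback :=
  @Pullback (g w, h w) (introT eqP (gh w)).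

Lemma pullback_lift_is_linear : linear pullback_lift.
Proof. by move=> a v w; apply: pullback_ext; apply: linearP. Qed.

HB.instance Definition _ :=
  GRing.isLinear.Build R W pullback *:%R pullback_lift pullback_lift_is_linear.
End Lift.

End Pullback.

Section Pushout.
Variables (R : pzRingType) (A X V : lmodType R).
Variables (f : {linear A -> X}) (j : {linear A -> V}).

Definition antidiag (a : A) : V * X := (j a, - f a).

Lemma antidiag_is_linear : linear antidiag.
Proof. by move=> c a b; rewrite /antidiag !linearP. Qed.

HB.instance Definition _ :=
  GRing.isLinear.Build R A (V * X)%type *:%R antidiag antidiag_is_linear.

(* (V (+) X) / {(j a, - f a) | a in A} *)
Definition pushout := coker antidiag.
HB.instance Definition _ := GRing.Lmodule.on pushout.

Definition pushout_inl (v : V) : pushout := coker_pi antidiag (v, 0).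
Definition pushout_inr (x : X) : pushout := coker_pi antidiag (0, x).

Lemma pushout_inl_is_linear : linear pushout_inl.
Proof.
by move=> c v w; rewrite /pushout_inl -linearP; congr coker_pi; congr pair;
  rewrite /= scaler0 addr0.
Qed.
Lemma pushout_inr_is_linear : linear pushout_inr.
Proof.
by move=> c v w; rewrite /pushout_inr -linearP; congr coker_pi; congr pair;
  rewrite /= scaler0 addr0.
Qed.
HB.instance Definition _ :=
  GRing.isLinear.Build R V pushout *:%R pushout_inl pushout_inl_is_linear.
HB.instance Definition _ :=
  GRing.isLinear.Build R X pushout *:%R pushout_inr pushout_inr_is_linear.

Lemma pushout_comm a : pushout_inl (j a) = pushout_inr (f a).
Proof.
by apply/coker_pi_eq; exists a; congr pair; rewrite /= ?subr0 ?sub0r.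
Qed.

Lemma pushout_surj q : exists v x, pushout_inl v + pushout_inr x = q.
Proof.
have [[v x] <-] := coker_pi_surj q; exists v, x.
by rewrite -coker_piD; congr coker_pi; congr pair; rewrite /= ?addr0 ?add0r.
Qed.

Section Desc.
Variables (W : lmodType R) (g : {linear V -> W}) (h : {linear X -> W}).
Variable gh : forall a, g (j a) = h (f a).

Definition copair (t : V * X) : W := g t.1 + h t.2.

Lemma copair_is_linear : linear copair.
Proof. by move=> c s t; rewrite /copair !linearP scalerDr addrACA. Qed.
HB.instance Definition _ :=
  GRing.isLinear.Build R (V * X)%type W *:%R copair copair_is_linear.

Lemma copair_antidiag a : copair (antidiag a) = 0.
Proof. by rewrite /copair /= linearN gh subrr. Qed.

Definition pushout_desc : {linear pushout -> W} := coker_lift copair_antidiag.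

Lemma pushout_desc_inl v : pushout_desc (pushout_inl v) = g v.
Proof. by rewrite [LHS]coker_liftE /= /copair linear0 addr0. Qed.

Lemma pushout_desc_inr x : pushout_desc (pushout_inr x) = h x.
Proof. by rewrite [LHS]coker_liftE /= /copair linear0 add0r. Qed.
End Desc.

End Pushout.

(* [ses A C] : short exact sequences 0 -> A -> X -> C -> 0. *)
Record ses (R : pzRingType) (A C : lmodType R) := Ses {
  ses_mid : lmodType R;
  ses_inj : {linear A -> ses_mid};
  ses_proj : {linear ses_mid -> C};
  ses_injP : injective ses_inj;
  ses_exactP : forall x, ses_proj x = 0 <-> exists a, ses_inj a = x;
  ses_projP : forall c, exists x, ses_proj x = c
}.

Section SesOperations.
Variable R : pzRingType.
Implicit Types A C V Z : lmodType R.

(* Yoneda equivalence; such a [phi] is automatically an isomorphism. *)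
Definition ses_equiv A C (E F : ses A C) : Prop :=
  exists phi : {linear ses_mid E -> ses_mid F},
    (forall a, phi (ses_inj E a) = ses_inj F a) /\
    (forall x, ses_proj F (phi x) = ses_proj E x).

Section Split.
Variables A C : lmodType R.

Definition split_inj (a : A) : A * C := (a, 0).
Lemma split_inj_is_linear : linear split_inj.
Proof. by move=> c a b; congr pair; rewrite /= scaler0 addr0. Qed.
HB.instance Definition _ :=
  GRing.isLinear.Build R A (A * C)%type *:%R split_inj split_inj_is_linear.

Lemma split_injP : injective split_inj.
Proof. by move=> a b []. Qed.
Lemma split_exactP (x : A * C) : x.2 = 0 <-> exists a, split_inj a = x.
Proof. by case: x => a c /=; split=> [->|[b []]//]; exists a. Qed.
Lemma split_projP (c : C) : exists x : A * C, x.2 = c.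
Proof. by exists (0, c). Qed.

Definition ses_split : ses A C :=
  @Ses R A C (A * C)%type split_inj snd split_injP split_exactP split_projP.
End Split.

Section SesPushout.
Variables (A C V : lmodType R) (j : {linear A -> V}) (E : ses A C).
Let P := pushout (ses_inj E) j.

Lemma ses_pushout_subproof (a : A) :
  (\0 : {linear V -> C}) (j a) = ses_proj E (ses_inj E a).
Proof. by apply/esym/ses_exactP; exists a. Qed.

Definition ses_pushout_proj : {linear P -> C} := pushout_desc ses_pushout_subproof.

Lemma ses_pushout_injP : injective (pushout_inl (ses_inj E) j).
Proof.
move=> v w /coker_pi_eq[a [ja]]; rewrite /= subr0 => /eqP.
rewrite oppr_eq0 -(linear0 (ses_inj E)) => /eqP/ses_injP a0.
by apply/eqP; rewrite -subr_eq0 -ja a0 linear0.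
Qed.

Lemma ses_pushout_exactP x :
  ses_pushout_proj x = 0 <-> exists v, pushout_inl (ses_inj E) j v = x.
Proof.
split=> [|[v <-]]; last by rewrite pushout_desc_inl.
have [v [y <-]] := pushout_surj x.
rewrite linearD pushout_desc_inl pushout_desc_inr add0r => /ses_exactP[a <-].
by exists (v + j a); rewrite linearD /= pushout_comm.
Qed.

Lemma ses_pushout_projP c : exists x, ses_pushout_proj x = c.
Proof.
have [x <-] := ses_projP E c.
by exists (pushout_inr _ j x); rewrite pushout_desc_inr.
Qed.

Definition ses_pushout : ses V C :=
  Ses ses_pushout_injP ses_pushout_exactP ses_pushout_projP.
End SesPushout.

Section SesPullback.
Variables (A C Z : lmodType R) (i : {linear Z -> C}) (E : ses A C).
Let P := pullback (ses_proj E) i.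

Lemma ses_pullback_subproof (a : A) :
  ses_proj E (ses_inj E a) = i ((\0 : {linear A -> Z}) a).
Proof. by rewrite linear0; apply/ses_exactP; exists a. Qed.

Definition ses_pullback_inj : {linear A -> P} := pullback_lift ses_pullback_subproof.

Lemma ses_pullback_injP : injective ses_pullback_inj.
Proof. by move=> a b /(congr1 (@pullback_fst _ _ _ _ _ _)) /ses_injP. Qed.

Lemma ses_pullback_exactP (x : P) :
  pullback_snd x = 0 <-> exists a, ses_pullback_inj a = x.
Proof.
split=> [x0|[a <-] //].
have /ses_exactP[a Ea] : ses_proj E (pullback_fst x) = 0.
  by rewrite pullback_comm x0 linear0.
by exists a; apply: pullback_ext.
Qed.

Lemma ses_pullback_projP z : exists x : P, pullback_snd x = z.
Proof.
have [x Ex] := ses_projP E (i z).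
by exists (@Pullback _ _ _ _ (ses_proj E) i (x, z) (introT eqP Ex)).
Qed.

Definition ses_pullback : ses A Z :=
  Ses ses_pullback_injP ses_pullback_exactP ses_pullback_projP.
End SesPullback.

(* The zero of Ext^1(Z, V) is the class of the split sequence, so this says
   that the map Ext^1(i, j) : Ext^1(Y, U) -> Ext^1(Z, V) is zero. *)
Definition Ext1_map_eq0 (Z Y U V : lmodType R)
    (i : {linear Z -> Y}) (j : {linear U -> V}) : Prop :=
  forall E : ses U Y,
    ses_equiv (ses_pullback i (ses_pushout j E)) (ses_split V Z).

End SesOperations.

Definition hom_class (R : pzRingType) : Type :=
  forall M N : lmodType R, {linear M -> N} -> Prop.

Record is_ideal (R : pzRingType) (I : hom_class R) : Prop := IsIdeal {
  ideal0 : forall M N : lmodType R, I M N \0;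
  idealD : forall (M N : lmodType R) (f g : {linear M -> N}),
    I M N f -> I M N g -> I M N (f \+ g);
  idealN : forall (M N : lmodType R) (f : {linear M -> N}),
    I M N f -> I M N (\- f);
  ideal_comp : forall (M' M N N' : lmodType R) (f : {linear N -> N'})
    (g : {linear M -> N}) (h : {linear M' -> M}),
    I M N g -> I M' N' (f \o g \o h)
}.

(* The direct sum of K copies of M; the cardinal is represented by a type K. *)
Definition copower (R : pzRingType) (K : Type) (M : lmodType R) : lmodType R :=
  dsum (fun _ : K => M).

Definition copower_map (R : pzRingType) (K : Type) (M N : lmodType R)
    (f : {linear M -> N}) : {linear copower K M -> copower K N} :=
  dsum_map (fun _ : K => f).

Definition generated_extended (R : pzRingType) (I : hom_class R)
    (S : Type) (M N : S -> lmodType R) (f : forall s, {linear M s -> N s}) : Prop :=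
  forall (U V : lmodType R) (g : {linear U -> V}),
    I U V g <->
    exists (K : S -> Type)
           (a : {linear U -> dsum (fun s => copower (K s) (M s))})
           (b : {linear dsum (fun s => copower (K s) (N s)) -> V}),
      forall u, g u = b (dsum_map (fun s => copower_map (K s) (f s)) (a u)).

Definition set_generated_extended (R : pzRingType) (I : hom_class R) : Prop :=
  exists (S : Type) (M N : S -> lmodType R) (f : forall s, {linear M s -> N s}),
    generated_extended I f.

Definition perp (R : pzRingType) (I : hom_class R) : hom_class R :=
  fun (U V : lmodType R) (j : {linear U -> V}) =>
    forall (Z Y : lmodType R) (i : {linear Z -> Y}), I Z Y i -> Ext1_map_eq0 i j.

Definition is_preenvelope (R : pzRingType) (J : hom_class R)
    (U V : lmodType R) (j : {linear U -> V}) : Prop :=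
  J U V j /\
  forall (V' : lmodType R) (j' : {linear U -> V'}), J U V' j' ->
    exists h : {linear V -> V'}, forall u, j' u = h (j u).

Record is_preenveloping_ideal (R : pzRingType) (J : hom_class R) : Prop :=
  IsPreenvelopingIdeal {
    preenveloping_is_ideal : is_ideal J;
    preenveloping_exists : forall U : lmodType R,
      exists (V : lmodType R) (j : {linear U -> V}), is_preenvelope J j
  }.

(* Main.v *)
Require Import Defs.
From HB Require Import structures.
From mathcomp Require Import all_boot all_algebra finmap.
From mathcomp Require Import boolp classical_sets cardinality fsbigop.

(** Let the ideal I be generated by the maps f_s : M_s -> N_s.  For each s fix
    a short exact sequence 0 -> K_s -> F_s -> N_s -> 0 with F_s free, and pull
    it back along f_s to 0 -> K_s -> P_s -> M_s -> 0.  The whole proof rests on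
    one characterization ([perp_generatedP]): a map j : U -> V is in the perp
    class of I if and only if, for every s and every k : K_s -> U, the map j k
    extends along K_s -> P_s to a map P_s -> V.

    This holds for two reasons.  First, Ext^1(i, j) kills an extension E of Y
    by U exactly when i : Z -> Y lifts through the projection of the pushout
    of E along j ([Ext1_map_eq0P]).  Lifting problems out of a direct sum are
    solved one summand at a time, so it is enough to treat the composites
    b f_s with b : N_s -> Y.  Second, F_s being free, such a b lifts to a map
    l from F_s to the middle term of E; l restricts to some k : K_s -> U, and
    lifts of b f_s correspond to extensions of j k
    ([extends_lift_pushout]).  Conversely, every k arises from the pushout of
    the free presentation along k ([Ext1_map_eq0_extends]).

    The extension condition involves only a set of maps K_s -> P_s.  It is
    stable under sums, opposites and compositions, so the perp class is an
    ideal ([extension_ideal]).  A preenvelope of U is then obtained by solving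
    all extension problems at once: push U out along the direct sum of the
    maps K_s -> P_s, one copy for each pair of an index s and a map
    K_s -> U ([extension_preenvelope]).  The extensions needed for U -> V are
    built into the pushout.  A further map j' : U -> V' in the perp class
    comes with extensions P_s -> V' of all its composites j' k, which by the
    universal property yield V -> V'.  No iteration is necessary, because the
    condition only concerns maps into U and not maps into V. *)

Set Implicit Arguments.
Unset Strict Implicit.
Unset Printing Implicit Defensive.

Import GRing.Theory.
Local Open Scope classical_set_scope.
Local Open Scope ring_scope.

(** * Factorization of linear maps *)

Section LinearMaps.
Variable R : pzRingType.
Implicit Types U V W X : lmodType R.

Definition linear_of U V (g : U -> V) (lin_g : linear g) : {linear U -> V} :=
  HB.pack g (GRing.isLinear.Build R U V *:%R g lin_g).

Lemma factor_surj U V W (p : {linear U -> V}) (t : {linear U -> W}) :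
  (forall v, exists u, p u = v) -> (forall u, p u = 0 -> t u = 0) ->
  exists h : {linear V -> W}, forall u, h (p u) = t u.
Proof.
move=> /choice[s sK] ker_t.
have tE u u' : p u = p u' -> t u = t u'.
  by move=> E; apply/eqP; rewrite -subr_eq0 -linearB ker_t // linearB E subrr.
have lin : linear (fun v => t (s v)).
  by move=> a v w; rewrite -linearP; apply: tE; rewrite linearP !sK.
by exists (linear_of lin) => u; apply: tE; rewrite sK.
Qed.

Lemma factor_inj U V W (i : {linear V -> W}) (t : {linear U -> W}) :
  injective i -> (forall u, exists v, i v = t u) ->
  exists h : {linear U -> V}, forall u, i (h u) = t u.
Proof.
move=> inj_i /choice[s sE].
have lin : linear s by move=> a u v; apply: inj_i; rewrite linearP !sE linearP.
by exists (linear_of lin).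
Qed.

End LinearMaps.

(** * Universal property of the direct sum *)

Section DirectSums.
Variables (R : pzRingType) (I : Type) (M : I -> lmodType R).

(** The index type has no decidable equality, so the comparison with [i] is
    classical and the value is transported along the resulting equation. *)
Definition dsum_single (i : I) (m : M i) (k : I) : M k :=
  if pselect (i = k) is left e then ecast k (M k) e m else 0.

Lemma dsum_single_same i m : dsum_single m i = m.
Proof.
rewrite /dsum_single; case: pselect => [e|//].
by rewrite (Prop_irrelevance e erefl).
Qed.

Lemma dsum_single_other i m k : i <> k -> dsum_single (i := i) m k = 0.
Proof. by rewrite /dsum_single; case: pselect. Qed.

Lemma dsum_single_fin i (m : M i) : fin_supp (dsum_single m).
Proof.
apply: (sub_finite_set _ (finite_set1 i)) => k /=.
by have [<- //|/dsum_single_other->] := pselect (i = k).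
Qed.

Definition dsum_in_fun i (m : M i) : dsum M := Dsum (dsum_single_fin m).

Lemma dsum_in_is_linear i : linear (@dsum_in_fun i).
Proof.
move=> a m n; apply: dsum_ext => k /=.
have [<-|ik] := pselect (i = k); first by rewrite !dsum_single_same.
by rewrite !dsum_single_other // scaler0 addr0.
Qed.

Definition dsum_in i : {linear M i -> dsum M} :=
  linear_of (@dsum_in_is_linear i).

Section Copairing.
Variables (W : lmodType R) (g : forall i, {linear M i -> W}).

(** Big operators require a choiceType of indices, which [{classic I}]
    provides. *)
Definition dsum_copair_fun (x : dsum M) : W :=
  \sum_(i \in [set: {classic I}]) g i (x i).

(** Linearity compares sums over different supports; this allows them to be
    taken over a common finite set. *)
Lemma dsum_copair_funE (D : set {classic I}) (x : dsum M) :
    finite_set D -> (forall i, x i <> 0 -> D i) ->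
  dsum_copair_fun x = \sum_(i <- fset_set D) g i (x i).
Proof.
move=> finD subD; rewrite -fsbig_finite //.
apply/esym/fsbig_widen => // i [_ /= Di].
have [->|/subD//] := pselect (x i = 0); exact: linear0.
Qed.

Lemma dsum_copair_is_linear : linear dsum_copair_fun.
Proof.
move=> a x y.
pose D : set {classic I} := [set i | x i <> 0] `|` [set i | y i <> 0].
have finD : finite_set D by rewrite finite_setU; split; apply: dsum_fin.
rewrite !(dsum_copair_funE finD).
- rewrite scaler_sumr -big_split /=; apply: eq_bigr => i _; exact: linearP.
- by move=> i; right.
- by move=> i; left.
move=> i /= xy; have [x0|x0] := pselect (x i = 0); last by left.
by right=> y0; apply: xy; rewrite x0 y0 scaler0 addr0.
Qed.

Definition dsum_copair : {linear dsum M -> W} :=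
  linear_of dsum_copair_is_linear.

Lemma dsum_copair_in i m : dsum_copair (dsum_in i m) = g i m.
Proof.
rewrite [LHS](@dsum_copair_funE [set i]) ?fset_set1 ?big_seq_fset1.
- by rewrite /= dsum_single_same.
- exact: finite_set1.
by move=> k /= mk; apply: contra_notP mk => /nesym/dsum_single_other.
Qed.

End Copairing.

(** Every family is the finite sum of its components; this is what makes
    linear maps out of a direct sum determined by their restrictions. *)
Lemma dsum_sum_in (x : dsum M) : dsum_copair dsum_in x = x.
Proof.
pose D : set {classic I} := [set i | x i <> 0].
have finD : finite_set D := dsum_fin x.
apply: dsum_ext => k.
(* Evaluation at [k] is linear, hence commutes with the sum. *)
pose ev (y : dsum M) := y k.
have lin_ev : linear ev by [].
rewrite -[LHS]/(linear_of lin_ev _) [dsum_copair _ _](dsum_copair_funE _ finD) //.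
rewrite linear_sum /= /ev /=.
have [xk|xk] := pselect (x k = 0).
  rewrite xk big1 // => i _.
  have [->|/dsum_single_other->//] := pselect (i = k).
  by rewrite dsum_single_same.
rewrite (bigD1_seq (k : {classic I})) ?fset_uniq //=; last first.
  by rewrite in_fset_set // inE.
rewrite dsum_single_same big1 ?addr0 // => i /eqP ik.
exact: dsum_single_other.
Qed.

Lemma dsum_hom_ext (W : lmodType R) (g h : {linear dsum M -> W}) :
  (forall i m, g (dsum_in i m) = h (dsum_in i m)) -> forall x, g x = h x.
Proof.
move=> gh x; rewrite -[x]dsum_sum_in.
rewrite [dsum_copair _ _](dsum_copair_funE _ (dsum_fin x)) // !linear_sum.
by apply: eq_bigr => i _; apply: gh.
Qed.

End DirectSums.

Lemma dsum_map_in (R : pzRingType) (I : Type) (M N : I -> lmodType R)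
    (f : forall i, {linear M i -> N i}) i m :
  dsum_map f (dsum_in M i m) = dsum_in N i (f i m).
Proof.
apply: dsum_ext => k /=; have [<-|ik] := pselect (i = k).
  by rewrite !dsum_single_same.
by rewrite !dsum_single_other ?linear0.
Qed.

(** * Kernels and free presentations *)

Section Kernel.
Variables (R : pzRingType) (X Y : lmodType R) (p : {linear X -> Y}).

Definition ker_pred : {pred X} := fun x => p x == 0.

Lemma ker_pred_closed : submod_closed ker_pred.
Proof.
split=> [|a x y /eqP px /eqP py]; apply/eqP; first exact: linear0.
by rewrite linearP px py scaler0 addr0.
Qed.

HB.instance Definition _ :=
  GRing.isSubmodClosed.Build R X ker_pred ker_pred_closed.

Record ker := Ker { ker_val : X; ker_valP : ker_val \in ker_pred }.

HB.instance Definition _ := [isSub for ker_val].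
HB.instance Definition _ := [Choice of ker by <:].
HB.instance Definition _ := [SubChoice_isSubLmodule of ker by <:].

Lemma ker_val_is_linear : linear ker_val. Proof. by []. Qed.

Hypothesis p_surj : forall y, exists x, p x = y.

Lemma ker_exact x : p x = 0 <-> exists a, linear_of ker_val_is_linear a = x.
Proof.
split=> [/eqP px|[a <-]]; first by exists (@Ker x px).
exact/eqP/(ker_valP a).
Qed.

Definition ses_ker : ses ker Y :=
  @Ses R ker Y X (linear_of ker_val_is_linear) p val_inj ker_exact p_surj.

End Kernel.

Section FreePresentation.
Variables (R : pzRingType) (N : lmodType R).

Definition free_module : lmodType R := dsum (fun _ : N => R^o).

Lemma scale_is_linear (X : lmodType R) (x : X) :
  linear (fun a : R^o => (a : R) *: x).
Proof. by move=> a b c; rewrite scalerDl scalerA. Qed.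

Definition free_map (X : lmodType R) (x : N -> X) : {linear free_module -> X} :=
  dsum_copair (fun n => linear_of (scale_is_linear (x n))).

Definition free_gen (n : N) : free_module := dsum_in (fun _ : N => R^o) n 1.

Lemma free_map_gen (X : lmodType R) (x : N -> X) n :
  free_map x (free_gen n) = x n.
Proof. by rewrite [LHS]dsum_copair_in /= scale1r. Qed.

Lemma free_hom_ext (X : lmodType R) (g h : {linear free_module -> X}) :
  (forall n, g (free_gen n) = h (free_gen n)) -> forall c, g c = h c.
Proof.
move=> gh; apply: dsum_hom_ext => n a.
have -> : dsum_in (fun _ : N => R^o) n a = (a : R) *: free_gen n.
  rewrite /free_gen -linearZ_LR; congr (dsum_in _ n _).
  by rewrite /GRing.scale /= mulr1.
by rewrite !linearZ_LR gh.
Qed.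

Lemma free_map_surj n : exists x, free_map id x = n.
Proof. by exists (free_gen n); rewrite free_map_gen. Qed.

Definition free_ses : ses (ker (free_map id)) N := ses_ker free_map_surj.

Lemma free_lift (X Y : lmodType R) (p : {linear X -> Y})
    (b : {linear free_module -> Y}) :
  (forall y, exists x, p x = y) ->
  exists l : {linear free_module -> X}, forall c, p (l c) = b c.
Proof.
move=> /choice[s sK]; pose l := free_map (fun n => s (b (free_gen n))).
have lE n : (p \o l) (free_gen n) = b (free_gen n).
  by rewrite -[LHS]/(p (l _)) free_map_gen sK.
by exists l; apply: free_hom_ext lE.
Qed.

End FreePresentation.

(** * Vanishing of Ext^1(i, j) as a lifting and as an extension property *)

Section Extension.
Variable R : pzRingType.
Implicit Types A B K M N U V Y Z : lmodType R.

(** A sequence splits if and only if its projection has a section, and the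
    sections of a pullback along [i] are the lifts of [i]. *)
Lemma Ext1_map_eq0P Z Y U V (i : {linear Z -> Y}) (j : {linear U -> V}) :
  Ext1_map_eq0 i j <-> forall E : ses U Y,
    exists t : {linear Z -> ses_mid (ses_pushout j E)},
      forall z, ses_proj (ses_pushout j E) (t z) = i z.
Proof.
split=> Eij E; set F := ses_pushout j E; last first.
  have [t tE] := Eij E; rewrite -/F in t tE.
  (* The lift [t] gives a section of the pullback; subtracting it leaves an
     element of V, and this defines the retraction onto V. *)
  pose d : {linear ses_mid (ses_pullback i F) -> ses_mid F} :=
    (@pullback_fst _ _ _ _ (ses_proj F) i
             \- (t \o @pullback_snd _ _ _ _ (ses_proj F) i))%R.
  have dE x : d x = pullback_fst x - t (pullback_snd x) by [].
  have [r rE] : exists r : {linear ses_mid (ses_pullback i F) -> V},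
      forall x, ses_inj F (r x) = d x.
    apply: factor_inj (@ses_injP _ _ _ F) _ => x; apply/ses_exactP.
    by rewrite dE linearB tE -pullback_comm subrr.
  have lin : linear (fun x => (r x, ses_proj (ses_pullback i F) x)).
    by move=> a x y; rewrite !linearP.
  exists (linear_of lin); split=> //= v; congr pair.
  by apply: (@ses_injP _ _ _ F); rewrite rE dE linear0 subr0.
have [phi [phi_inj phi_proj]] := Eij E; rewrite -/F in phi phi_inj phi_proj.
(* The first component of the splitting is a retraction onto V; subtracting it
   gives a map that vanishes on V, hence descends to Z. *)
pose d : {linear ses_mid (ses_pullback i F) -> ses_mid F} :=
    (@pullback_fst _ _ _ _ (ses_proj F) i
           \- (ses_inj F \o (fst \o phi)))%R.
have dE x : d x = pullback_fst x - ses_inj F (phi x).1 by [].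
have [t tE] : exists t : {linear Z -> ses_mid F},
    forall x, t (ses_proj (ses_pullback i F) x) = d x.
  apply: factor_surj (@ses_projP _ _ _ _) _ => x /ses_exactP[v <-].
  by rewrite dE phi_inj subrr.
exists t => z; have [x <-] := ses_projP (ses_pullback i F) z.
rewrite tE dE linearB pullback_comm.
have -> : ses_proj F (ses_inj F (phi x).1) = 0 by apply/ses_exactP; exists (phi x).1.
exact: subr0.
Qed.

(** For [j] the identity of [U], this is injectivity of [U] relative to
    [iota]. *)
Definition extends_along A B (iota : {linear A -> B}) U V
    (j : {linear U -> V}) : Prop :=
  forall k : {linear A -> U},
    exists e : {linear B -> V}, forall a, e (iota a) = j (k a).

(** Pushing [E] out along a given [k] produces an extension on which the
    vanishing of Ext^1(f, j) yields a lift of [f]; the difference between this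
    lift and the canonical map has values in V and extends [j \o k]. *)
Lemma Ext1_map_eq0_extends M N K U V (f : {linear M -> N}) (E : ses K N)
    (j : {linear U -> V}) :
  Ext1_map_eq0 f j -> extends_along (ses_inj (ses_pullback f E)) j.
Proof.
move=> /Ext1_map_eq0P fj k; have [t tE] := fj (ses_pushout k E).
set F := ses_pushout j _ in t tE.
pose d : {linear ses_mid (ses_pullback f E) -> ses_mid F} :=
  ((pushout_inr (ses_inj (ses_pushout k E)) j
            \o pushout_inr (ses_inj E) k)
             \o @pullback_fst _ _ _ _ (ses_proj E) f
           \- (t \o @pullback_snd _ _ _ _ (ses_proj E) f))%R.
have dE x : d x = pushout_inr _ j (pushout_inr _ k (pullback_fst x))
                  - t (pullback_snd x) by [].
have [e eE] : exists e : {linear ses_mid (ses_pullback f E) -> V},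
    forall x, ses_inj F (e x) = d x.
  apply: factor_inj (@ses_injP _ _ _ F) _ => x; apply/ses_exactP.
  rewrite dE linearB tE -pullback_comm.
  by rewrite !pushout_desc_inr subrr.
exists e => a; apply: (@ses_injP _ _ _ F); rewrite eE dE linear0 subr0.
by rewrite -[pushout_inr (ses_inj E) _ _]pushout_comm -pushout_comm.
Qed.

(** The map [l] covers [b], so it restricts to the kernels as some k : K -> U.
    Given an extension [e] of [j \o k] to the pullback, [l] and [e] agree on K
    as maps to the pushout, and their difference descends to the lift on M. *)
Lemma extends_lift_pushout M N K U V Y (f : {linear M -> N}) (E : ses K N)
    (j : {linear U -> V}) (E' : ses U Y) (b : {linear N -> Y})
    (l : {linear ses_mid E -> ses_mid E'}) :
  (forall x, ses_proj E' (l x) = b (ses_proj E x)) ->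
  extends_along (ses_inj (ses_pullback f E)) j ->
  exists t : {linear M -> ses_mid (ses_pushout j E')},
    forall m, ses_proj (ses_pushout j E') (t m) = b (f m).
Proof.
move=> lE fj; set F := ses_pushout j E'.
have [k kE] : exists k : {linear K -> U},
    forall a, ses_inj E' (k a) = (l \o ses_inj E)%FUN a.
  apply: factor_inj (@ses_injP _ _ _ _) _ => a; apply/ses_exactP => /=.
  rewrite lE; have -> : ses_proj E (ses_inj E a) = 0.
    by apply/ses_exactP; exists a.
  exact: linear0.
have [e eE] := fj k.
pose d : {linear ses_mid (ses_pullback f E) -> ses_mid F} :=
  ((pushout_inr (ses_inj E') j \o l)
             \o @pullback_fst _ _ _ _ (ses_proj E) f
           \- (pushout_inl (ses_inj E') j \o e))%R.
have dE x : d x = pushout_inr _ j (l (pullback_fst x)) - pushout_inl _ j (e x).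
  by [].
have [t tE] : exists t : {linear M -> ses_mid F},
    forall x, t (ses_proj (ses_pullback f E) x) = d x.
  apply: factor_surj (@ses_projP _ _ _ _) _ => x /ses_exactP[a <-].
  by rewrite dE eE pushout_comm kE subrr.
exists t => m; have [x <-] := ses_projP (ses_pullback f E) m.
rewrite tE dE linearB pushout_desc_inl subr0 pushout_desc_inr lE.
by rewrite pullback_comm.
Qed.

End Extension.

(** * The perp class of a generated ideal *)

Section PerpOfGenerated.
Variables (R : pzRingType) (I : hom_class R) (S : Type).
Variables (M N : S -> lmodType R) (f : forall s, {linear M s -> N s}).
Hypothesis genI : generated_extended I f.

Lemma generator_in s : I (f s).
Proof.
have lin : linear (fun x : dsum (fun t => copower (t = s) (N t)) => x s erefl).
  by [].
(* One copy of [f s] and none of the other generators: the copies of [f t] are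
   indexed by the proofs of [t = s]. *)
apply/genI; exists (fun t => t = s).
exists (dsum_in (fun t => copower (t = s) (M t)) s
        \o dsum_in (fun _ : s = s => M s) erefl)%FUN.
exists (linear_of lin) => u /=.
by rewrite !dsum_single_same /= dsum_single_same.
Qed.

Lemma perp_generatedP (U V : lmodType R) (j : {linear U -> V}) :
  perp I j <-> forall s,
    extends_along (ses_inj (ses_pullback (f s) (free_ses (N s)))) j.
Proof.
split=> [Ij s|fj Z Y i /genI[K [a [b iE]]]].
  exact/Ext1_map_eq0_extends/Ij/generator_in.
apply/Ext1_map_eq0P => E; set F := ses_pushout j E.
pose b' s (c : K s) : {linear N s -> Y} :=
  b \o (dsum_in (fun s => copower (K s) (N s)) s \o dsum_in (fun=> N s) c).
have lift s (c : K s) : exists t : {linear M s -> ses_mid F},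
    forall m, ses_proj F (t m) = b' s c (f s m).
  have [l lE] := free_lift (b' s c \o free_map id) (@ses_projP _ _ _ E).
  exact: (extends_lift_pushout (E := free_ses (N s)) lE).
pose h : {linear dsum (fun s => copower (K s) (M s)) -> ses_mid F} :=
  dsum_copair (fun s => dsum_copair (fun c => sval (cid (lift s c)))).
have hE x : (ses_proj F \o h) x
    = (b \o dsum_map (fun s => copower_map (K s) (f s))) x.
  move: x; apply: dsum_hom_ext => s y.
  rewrite -[LHS]/(ses_proj F (h _)) dsum_copair_in.
  rewrite -[RHS]/(b (dsum_map _ _)) dsum_map_in.
  pose bs := b \o (dsum_in (fun s => copower (K s) (N s)) s
                    \o copower_map (K s) (f s)).
  rewrite -[LHS]/((ses_proj F \o dsum_copair _) y) -[RHS]/(bs y).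
  move: y; apply: dsum_hom_ext => c m.
  rewrite -[LHS]/(ses_proj F (dsum_copair _ _)) dsum_copair_in.
  case: cid => t /= ->.
  by rewrite -[RHS]/(b (dsum_in _ s (dsum_map _ _))) dsum_map_in.
exists (h \o a) => z; rewrite iE; exact: hE.
Qed.

End PerpOfGenerated.

(** * Ideals defined by a set of extension problems *)

Section ExtensionIdeal.
Variables (R : pzRingType) (T : Type) (A B : T -> lmodType R).
Variables (iota : forall t, {linear A t -> B t}).
Variable J : hom_class R.
Hypothesis JP : forall (U V : lmodType R) (j : {linear U -> V}),
  J j <-> forall t, extends_along (iota t) j.

Lemma extension_ideal : is_ideal J.
Proof.
split=> [U V|U V j j' /JP Jj /JP Jj'|U V j /JP Jj|U' U V V' j' j j'' /JP Jj];
  apply/JP => t k.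
- by exists \0.
- have [[e eE] [e' eE']] := (Jj t k, Jj' t k).
  by exists (e \+ e')%R => x /=; rewrite eE eE'.
- by have [e eE] := Jj t k; exists (\- e)%R => x /=; rewrite eE.
have [e eE] := Jj t (j'' \o k).
by exists (j' \o e) => x /=; rewrite eE.
Qed.

(** The pairs (t, A t -> U) form a set, so a single pushout along a direct sum
    indexed by them solves all the extension problems. *)
Lemma extension_preenvelope (U : lmodType R) :
  exists (V : lmodType R) (j : {linear U -> V}), is_preenvelope J j.
Proof.
pose T' := {t : T & {linear A t -> U}}.
pose k : {linear dsum (fun q : T' => A (tag q)) -> U} :=
  dsum_copair (fun q : T' => tagged q).
pose i : {linear dsum (fun q : T' => A (tag q)) ->
            dsum (fun q : T' => B (tag q))} :=
  dsum_map (fun q : T' => iota (tag q)).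
exists (pushout i k), (pushout_inl i k); split.
  apply/JP => t g; pose q : T' := Tagged _ g.
  exists (pushout_inr i k \o dsum_in (fun q : T' => B (tag q)) q) => a /=.
  have kE : k (dsum_in _ q a) = g a by apply: dsum_copair_in.
  have iE : i (dsum_in _ q a) = dsum_in _ q (iota t a) by apply: dsum_map_in.
  by rewrite -kE pushout_comm iE.
move=> V j /JP Jj.
pose h : {linear dsum (fun q : T' => B (tag q)) -> V} :=
  dsum_copair (fun q : T' => sval (cid (Jj (tag q) (tagged q)))).
have jh x : (j \o k) x = (h \o i) x.
  move: x; apply: dsum_hom_ext => q a.
  rewrite -[LHS]/(j (k _)) -[RHS]/(h (dsum_map _ _)) dsum_map_in !dsum_copair_in.
  by case: cid => e /= ->.
by exists (pushout_desc jh) => u; rewrite pushout_desc_inl.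
Qed.

End ExtensionIdeal.

Theorem corollary6p2 (R : pzRingType) (I : hom_class R) :
  is_ideal I -> set_generated_extended I -> is_preenveloping_ideal (perp I).
Proof.
move=> _ [S [M [N [f /perp_generatedP perpP]]]].
by split; [apply: extension_ideal perpP | apply: extension_preenvelope perpP].
Qed.
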